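(* Let $\alpha\in\mathbb{C}$ with $|\alpha|>1$, and put $s_\alpha=|\alpha|-2+\frac{1}{|\alpha|}$. As $n$ tends to infinity, the extreme eigenvalues of $A_{\alpha,n}$ converge exponentially to $-s_\alpha$ and $4+s_\alpha$, respectively: there is a constant $C_2(\alpha)>0$ depending only on $\alpha$ such that, for all sufficiently large $n$, $$|\lambda_{\alpha,n,1}+s_\alpha|\le\frac{C_2(\alpha)}{|\alpha|^n},\qquad |\lambda_{\alpha,n,n}-4-s_\alpha|\le\frac{C_2(\alpha)}{|\alpha|^n}.$$ Moreover, there exists $C_1(\alpha)>0$ such that for all sufficiently large $n$ and all $2\le j\le n-1$, $$\left|\lambda_{\alpha,n,j}-\lambda^{\mathrm{asympt}}_{\alpha,n,j}\right|\le\frac{C_1(\alpha)}{n^3},$$ where $$\lambda^{\mathrm{asympt}}_{\alpha,n,j}=g\left(\tfrac{j\pi}{n}\right)+\frac{g'\left(\tfrac{j\pi}{n}\right)\eta_{\alpha,j}\left(\tfrac{j\pi}{n}\right)}{n}+\frac{g'\left(\tfrac{j\pi}{n}\right)\eta_{\alpha,j}\left(\tfrac{j\pi}{n}\right)\eta_{\alpha,j}'\left(\tfrac{j\pi}{n}\right)+\frac12 g''\left(\tfrac{j\pi}{n}\right)\eta_{\alpha,j}\left(\tfrac{j\pi}{n}\right)^2}{n^2}.$$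
   Context: For $\alpha\in\mathbb{C}$ and an integer $n\ge 3$, $A_{\alpha,n}$ is the $n\times n$ complex matrix with all main diagonal entries equal to $2$, all entries on the first subdiagonal and on the first superdiagonal equal to $-1$, the $(1,n)$ entry equal to $-\overline{\alpha}$, the $(n,1)$ entry equal to $-\alpha$, and all other entries $0$. It is Hermitian, and its (real) eigenvalues, counted with multiplicity, are enumerated in ascending order: $\lambda_{\alpha,n,1}\le\cdots\le\lambda_{\alpha,n,n}$. The function $g$ is $g(x)=4\sin^2(x/2)$. For $\alpha\in\mathbb{C}\setminus\{-1,1\}$ put $k_\alpha=\frac{1-|\alpha|^2}{|1+\alpha|^2}$, $l_\alpha=\frac{|1-\alpha|}{|1+\alpha|}$, and for every integer $j$ and $x\in(0,\pi)$ put $$\eta_{\alpha,j}(x)=-2\arctan\left(\left((-1)^{j+1}k_\alpha\cot(x)+\sqrt{k_\alpha^2\cot^2(x)+l_\alpha^2}\right)^{(-1)^j}\right).$$ *)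

(* Defs.v *)
From HB Require Import structures.
From mathcomp Require Import all_boot all_order all_algebra.
From mathcomp Require Import all_classical all_reals all_analysis.
From mathcomp Require Import complex.

Set Implicit Arguments.
Unset Strict Implicit.
Unset Printing Implicit Defensive.

Import Order.TTheory GRing.Theory Num.Theory.
Import numFieldNormedType.Exports.

Local Open Scope classical_set_scope.
Local Open Scope ring_scope.
Local Open Scope complex_scope.

(* The modulus as a real number; the norm `|z| of the library has values
   in R[i]. *)
Definition cmod (R : realType) (z : R[i]) : R := Normc.normc z.

(* The indices are 0-based. For n < 3 the corners overlap the three diagonals,
   and the first matching clause wins. *)
Definition Amx (R : realType) (alpha : R[i]) (n : nat) : 'M[R[i]]_n :=
  \matrix_(i < n, j < n)
    if i == j :> nat then 2
    else if (i.+1 == j :> nat) || (j.+1 == i :> nat) then -1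
    else if (i == 0 :> nat) && (j == n.-1 :> nat) then - (Num.conj alpha)
    else if (i == n.-1 :> nat) && (j == 0 :> nat) then - alpha
    else 0.

(* The real parts of the roots of the characteristic polynomial, with
   multiplicity, in ascending order; see eigenvaluesP for Hermitian A. *)
Definition eigenvalues (R : realType) (n : nat) (A : 'M[R[i]]_n) : seq R :=
  sort <=%R
    [seq complex.Re z | z <- sval (closed_field_poly_normal (char_poly A))].

(* The j-th smallest eigenvalue, j = 1, ..., n. *)
Definition lambda (R : realType) (alpha : R[i]) (n j : nat) : R :=
  nth 0 (eigenvalues (Amx alpha n)) j.-1.

Definition g (R : realType) (x : R) : R := 4 * sin (x / 2) ^+ 2.

Definition cot (R : realType) (x : R) : R := cos x / sin x.

Definition k_ (R : realType) (alpha : R[i]) : R :=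
  (1 - cmod alpha ^+ 2) / cmod (1 + alpha) ^+ 2.

Definition l_ (R : realType) (alpha : R[i]) : R :=
  cmod (1 - alpha) / cmod (1 + alpha).

Definition eta (R : realType) (alpha : R[i]) (j : int) (x : R) : R :=
  - 2 * atan (((-1) ^ (j + 1) * k_ alpha * cot x
               + Num.sqrt (k_ alpha ^+ 2 * cot x ^+ 2 + l_ alpha ^+ 2))
              ^ ((-1) ^ j : int)).

Definition s_ (R : realType) (alpha : R[i]) : R :=
  cmod alpha - 2 + (cmod alpha)^-1.

Definition lambda_asympt (R : realType) (alpha : R[i]) (n j : nat) : R :=
  let x := j%:R * pi / n%:R in
  let e := eta alpha j%:Z in
  g x + derive1 (@g R) x * e x / n%:R
  + (derive1 (@g R) x * e x * derive1 e x + 1 / 2 * derive1n 2 (@g R) x * e x ^+ 2)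
    / n%:R ^+ 2.

Lemma Amx_hermitian (R : realType) (alpha : R[i]) (n : nat) :
  Amx alpha n \is hermsymmx.
Proof.
apply/is_hermitianmxP; rewrite expr0 scale1r; apply/matrixP => i j.
rewrite !mxE [j == i :> nat]eq_sym [(j.+1 == i :> nat) || _]orbC.
case: ifP => ij; first by rewrite conjC_nat.
case: ifP => _; first by rewrite rmorphN rmorph1.
rewrite [(j == 0 :> nat) && _]andbC [(j == n.-1 :> nat) && _]andbC.
case: (boolP ((i == 0 :> nat) && _)) => [/andP[/eqP i0 /eqP jn]|_].
  case: ifP => [/andP[/eqP in1 /eqP j0]|_]; last by rewrite rmorphN.
  by rewrite i0 j0 in ij.
by case: ifP => _; [rewrite rmorphN /= conjCK | rewrite rmorph0].
Qed.

Lemma eigenvaluesP (R : realType) (n : nat) (A : 'M[R[i]]_n) :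
  A \is hermsymmx ->
  char_poly A = \prod_(x <- eigenvalues A) ('X - (x%:C)%:P).
Proof.
move=> Ah; rewrite /eigenvalues; case: closed_field_poly_normal => r /= cE.
rewrite (eqP (char_poly_monic A)) scale1r in cE.
suff rr : {in r, forall z, (complex.Re z)%:C = z}.
  rewrite cE (perm_big _ (permEl (perm_sort _ _))) big_map.
  by apply: eq_big_seq => z /rr ->.
move=> z zr; apply: RRe_real.
have : root (char_poly A) z by rewrite cE root_prod_XsubC.
rewrite -eigenvalue_root_char => /eigenvalueP[v vA v0].
have AE := orthomx_spectralP (hermitian_normalmx Ah).
have Pu := spectral_unit A.
set P := spectralmx A in AE Pu; set d := spectral_diag A in AE.
have wE : (v *m invmx P) *m diag_mx d = z *: (v *m invmx P).
  by rewrite scalemxAl -vA [in RHS]AE !mulmxA mulmxK.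
have /rV0Pn[i wi0] : v *m invmx P != 0.
  by apply: contra_neq v0 => w0; rewrite -(mulmxKV Pu v) w0 mul0mx.
have /rowP/(_ i) := wE; rewrite mul_mx_diag mxE [RHS]mxE mulrC => /(mulIf wi0) <-.
by have /mxOverP := hermitian_spectral_diag_real Ah; apply.
Qed.

(* Main.v *)
Require Import Defs.
From mathcomp Require Import all_boot all_order all_algebra.
From mathcomp Require Import all_classical all_reals all_analysis.
From mathcomp Require Import complex.
From mathcomp Require Import ring lra zify.

(** For 2 - t to be an eigenvalue of A_{alpha,n}, the solution of the
    three-term recurrence w_{k+2} = t w_{k+1} - w_k must satisfy the twisted
    boundary conditions w_0 = alpha w_n and w_{n+1} = conj(alpha) w_1.  With
    U_k(t) the solution starting at 0, 1 (a Chebyshev polynomial), such a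
    nonzero solution exists as soon as
      U_{n+1}(t) - |alpha|^2 U_{n-1}(t) = 2 Re alpha,
    and it is an eigenvector ([chebU_root_char_poly]).  No determinant is
    computed: it suffices to exhibit n distinct solutions of this equation, for
    they are then all the eigenvalues, and sorting them gives the lambda_j
    ([lambda_unique], [lambda_located]).

    Inside the band, t = 2 cos x with 0 < x < pi turns the equation into
      sin((n+1)x) - |alpha|^2 sin((n-1)x) = 2 (Re alpha) sin x,
    which is linear in sin(nx), cos(nx), hence quadratic in tan(nx/2); the
    choice of a root of the quadratic is exactly nx = j pi + eta_j(x)
    ([eta_root]).  As eta_j takes its values in (-pi, 0), the intermediate value
    theorem gives a solution x_j in ((j-1)pi/n, j pi/n) for 2 <= j <= n-1
    ([eta_fixpoint]); these intervals are disjoint, so the x_j are distinct.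

    The expansion of lambda_j = g(x_j) is the substitution of
    x_j = theta + eta_j(x_j)/n, theta = j pi/n, into itself and then into g
    ([perturbed_expansion]).  The error is O(n^-3) uniformly in j because eta_j
    and eta_j' are Lipschitz on the whole open interval (0, pi), although the
    formula for eta_j involves cot.  The reason is that eta = eta_j satisfies
    the regular trigonometric equation H(x, eta) = 0, with
      H(x, y) = A sin y cos x - B cos y sin x + p sin x,
      A = |alpha|^2 - 1,  B = |alpha|^2 + 1,  p = (-1)^j 2 Re alpha,
    so that eta' = - H_x / H_y, and on this curve
      H_y^2 = A^2 cos^2 x + (B^2 - p^2) sin^2 x >= A^2 > 0
    ([phase_derive], [phase_den_ge]).

    Outside the band, t = r + 1/r with r > 1 turns the left-hand side, times
    r - 1/r, into r^{n-1} (r^2 - |alpha|^2) plus a bounded term, whose sign changes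
    within O(|alpha|^-n) of r = |alpha| ([outer_root]).  The smallest eigenvalue is
    2 - r - 1/r.  The largest one is 2 + r + 1/r for a root r of the equation with
    (-1)^n Re alpha in place of Re alpha, by the parity of U_k
    ([outer_eigenvalues]). *)

Import Order.TTheory GRing.Theory Num.Theory.
Import numFieldNormedType.Exports.

Local Open Scope classical_set_scope.
Local Open Scope ring_scope.

Set Implicit Arguments.
Unset Strict Implicit.
Unset Printing Implicit Defensive.

(** * The spectral equation *)

(** The Chebyshev polynomial of the second kind of degree k - 1, at t / 2.  The
    shift gives the values 0 and 1 at k = 0 and 1, as for sin (k x) / sin x. *)
Fixpoint chebU (K : comNzRingType) (t : K) (k : nat) : K :=
  match k with
  | 0 => 0
  | k1.+1 => if k1 is k2.+1 then t * chebU t k1 - chebU t k2 else 1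
  end.

Arguments chebU : simpl never.

Lemma chebU0 (K : comNzRingType) (t : K) : chebU t 0 = 0. Proof. by []. Qed.
Lemma chebU1 (K : comNzRingType) (t : K) : chebU t 1 = 1. Proof. by []. Qed.

Lemma chebUSS (K : comNzRingType) (t : K) k :
  chebU t k.+2 = t * chebU t k.+1 - chebU t k.
Proof. by []. Qed.

(** The Casoratian of two shifted solutions of the recurrence is constant. *)
Lemma chebU_cassini (K : comNzRingType) (t : K) k :
  chebU t k.+1 ^+ 2 - chebU t k.+2 * chebU t k = 1.
Proof.
elim: k => [|k IH]; first by rewrite chebU1 chebU0 expr1n mulr0 subr0.
by rewrite -[RHS]IH [chebU t k.+3]chebUSS chebUSS; ring.
Qed.

Lemma chebU_morph (K L : comNzRingType) (f : {rmorphism K -> L}) t k :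
  chebU (f t) k = f (chebU t k).
Proof.
suff [] : chebU (f t) k = f (chebU t k) /\ chebU (f t) k.+1 = f (chebU t k.+1).
  by [].
elim: k => [|k [IH1 IH2]]; first by rewrite chebU1 chebU0 rmorph0 rmorph1.
by split=> //; rewrite !chebUSS rmorphB rmorphM IH1 IH2.
Qed.

Lemma chebU_opp (K : comNzRingType) (t : K) k :
  chebU (- t) k = (-1) ^+ k.+1 * chebU t k.
Proof.
suff [] : chebU (- t) k = (-1) ^+ k.+1 * chebU t k /\
  chebU (- t) k.+1 = (-1) ^+ k.+2 * chebU t k.+1 by [].
elim: k => [|k [IH1 IH2]]; first by rewrite chebU1 chebU0 mulr0 !exprS expr0 !mulr1 mulrNN mulr1.
by split=> //; rewrite !chebUSS IH1 IH2 !exprS; ring.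
Qed.

Lemma chebU_sin (R : realType) (x : R) k :
  sin x * chebU (2 * cos x) k = sin (k%:R * x).
Proof.
suff [] : sin x * chebU (2 * cos x) k = sin (k%:R * x) /\
  sin x * chebU (2 * cos x) k.+1 = sin (k.+1%:R * x) by [].
elim: k => [|k [IH1 IH2]]; first by rewrite chebU1 chebU0 mul0r sin0 mul1r mulr0 mulr1.
split=> //; rewrite chebUSS.
have -> : k.+2%:R * x = k.+1%:R * x + x by rewrite [k.+2%:R]mulrSr; ring.
have : sin (k%:R * x) = sin (k.+1%:R * x - x).
  by congr sin; rewrite [k.+1%:R]mulrSr; ring.
by rewrite sinB sinD -IH1 -IH2 => E; ring: E.
Qed.

Lemma chebU_hyp (F : fieldType) (r : F) k : r != 0 ->
  (r - r^-1) * chebU (r + r^-1) k = r ^+ k - r ^- k.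
Proof.
move=> r0; suff [] : (r - r^-1) * chebU (r + r^-1) k = r ^+ k - r ^- k /\
  (r - r^-1) * chebU (r + r^-1) k.+1 = r ^+ k.+1 - r ^- k.+1 by [].
elim: k => [|k [IH1 IH2]]; first by rewrite chebU1 chebU0 expr0 expr1 invr1 mulr0 mulr1 subrr.
split=> //; rewrite chebUSS mulrBr mulrCA IH1 IH2 !exprS.
have rk0 : r ^+ k != 0 by rewrite expf_neq0.
by field; rewrite rk0 r0.
Qed.

Lemma sum_indicator (K : nzRingType) (n m : nat) (F : nat -> K) :
  \sum_(i < n) F i * (i == m :> nat)%:R = if (m < n)%N then F m else 0.
Proof.
case: ifP => [mn|/negbT]; last first.
  rewrite -leqNgt => nm; apply: big1 => i _.
  by rewrite ltn_eqF ?mulr0 // (leq_trans (ltn_ord i)).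
rewrite (bigD1 (Ordinal mn)) //= eqxx mulr1 big1 ?addr0 // => i im.
by move: im; rewrite -val_eqE /= => /negbTE ->; rewrite mulr0.
Qed.

(** The two boundary conditions are a homogeneous 2 x 2 system in w_0 and w_1,
    whose determinant vanishes under the hypothesis.  With U_k = chebU t k and
    n = m + 1, the solution w_1 = U_n, w_0 = U_{n+1} - b comes from the second
    condition; the first one then follows by [chebU_cassini].  This w can only
    vanish when U_n = 0 and U_{n+1} = b, and then b ^+ 2 = 1. *)
Lemma twisted_solution (K : comNzRingType) (t a b : K) m :
  chebU t m.+2 - a * b * chebU t m = a + b ->
  exists w : nat -> K,
    [/\ forall k, w k.+2 = t * w k.+1 - w k, w 0%N = a * w m.+1,
        w m.+2 = b * w 1%N & w 1%N = 0 -> w 2%N = 0 -> b ^+ 2 = 1].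
Proof.
move=> E; have C := chebU_cassini t m; have U := chebUSS t m.
set x := chebU t m.+2 in E C U; set y := chebU t m.+1 in C U.
set z := chebU t m in E C U.
have {}E : x = a + b + a * b * z by rewrite -E; ring.
have {}C : y ^+ 2 = 1 + x * z by rewrite -C; ring.
exists (fun k => if k is k1.+1 then y * chebU t k1.+1 - (x - b) * chebU t k1
                 else x - b); split.
- by case=> [|k]; rewrite /= ?chebUSS ?chebU1 ?chebU0; ring.
- rewrite /= -/y -/z; ring: C E.
- by rewrite /= -/x -/y chebU1 chebU0; ring.
- rewrite /= chebUSS chebU1 chebU0 => y0 x0; have {}y0 : y = 0 by rewrite -[RHS]y0; ring.
  have {}x0 : b = x by apply/eqP; rewrite -subr_eq0 -[X in _ == X]x0 y0; apply/eqP; ring.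
  (* With y = 0, the recurrence and the Casoratian give z = - x and x ^+ 2 = 1. *)
  have zE : z = - x by rewrite U y0; ring.
  have {}C : 1 + x * z = 0 by rewrite -C y0 expr0n.
  by apply/eqP; rewrite x0 -subr_eq0 -oppr_eq0 -[X in _ == X]C zE; apply/eqP; ring.
Qed.

(** Eigenvectors are row vectors, so it is the transpose of the matrix, that is
    its conjugate, that acts: this is why alpha multiplies w_n. *)
Lemma chebU_root_char_poly (R : realType) (alpha : R[i]) (m : nat) (t : R) :
  (2 <= m)%N -> 1 < cmod alpha ->
  chebU t m.+2 - cmod alpha ^+ 2 * chebU t m = 2 * complex.Re alpha ->
  root (char_poly (Amx alpha m.+1)) ((2 - t)%:C)%C.
Proof.
move=> m2 a1 Ht.
pose T : R[i] := (t%:C)%C; pose beta : R[i] := Num.conj alpha.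
have abE : alpha * beta = ((cmod alpha ^+ 2)%:C)%C.
  rewrite /beta -normCK normc_def rmorphXn /=; congr ((_)%:C ^+ 2)%C.
  by rewrite /cmod /=; case: (alpha).
have HT : chebU T m.+2 - alpha * beta * chebU T m = alpha + beta.
  rewrite /T !chebU_morph abE -rmorphM -rmorphB Ht rmorphM /=.
  by rewrite [RHS]addcJ rmorph_nat.
have [w [wrec w0 wn wz]] := twisted_solution HT.
rewrite -eigenvalue_root_char; apply/eigenvalueP.
exists (\row_(i < m.+1) w i.+1); last first.
  have m1 : (1 < m.+1)%N by rewrite ltnS ltnW.
  apply/eqP => /rowP W.
  have := W (Ordinal m1); have := W ord0; rewrite !mxE /= => W1 W2.
  have := wz W1 W2 => /(congr1 (fun z => Num.conj z)).
  rewrite rmorphXn /= conjCK rmorph1 => /(congr1 (@cmod R)).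
  rewrite /cmod expr2 Normc.normcM Normc.normc1 => A.
  by move: a1; rewrite /cmod; nra.
apply/rowP => j; rewrite !mxE.
under eq_bigr => i _ do rewrite !mxE.
pose d (a b : nat) : R[i] := (a == b)%:R.
(* For m >= 2 the corners do not meet the three diagonals, so an entry is a
   sum of indicators; j - 1 is special-cased because it truncates at j = 0. *)
have entry (i : 'I_m.+1) :
  (if i == j :> nat then 2
    else if (i.+1 == j :> nat) || (j.+1 == i :> nat) then -1
    else if (i == 0 :> nat) && (j == m :> nat) then - beta
    else if (i == m :> nat) && (j == 0 :> nat) then - alpha else 0) =
  2 * d i j - (if nat_of_ord j is j1.+1 then d i j1 else 0) - d i j.+1
   - beta * d j m * d i 0%N - alpha * d j 0%N * d i m.
  have im : (i <= m)%N by rewrite -ltnS.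
  have jm : (j <= m)%N by rewrite -ltnS.
  move: (nat_of_ord i) (nat_of_ord j) im jm => {}i {}j im jm; rewrite /d.
  case: j jm => [|j] jm; rewrite ?eqSS;
  repeat (case: eqP => ? /=; try (exfalso; lia)); ring.
have D k := sum_indicator m.+1 k (fun k => w k.+1).
pose X i := if nat_of_ord j is j1.+1 then d i j1 else 0.
under eq_bigr => i _.
  rewrite entry (_ : _ * _ = 2 * (w i.+1 * d i j) - w i.+1 * X i
   - w i.+1 * d i j.+1 - beta * d j m * (w i.+1 * d i 0%N)
   - alpha * d j 0%N * (w i.+1 * d i m)); last by rewrite -/(X i); ring.
  over.
have XE : \sum_(i < m.+1) w i.+1 * X i = if (j : nat) == 0%N then 0 else w j.
  rewrite /X; case: (nat_of_ord j) (ltn_ord j) => [|j1] jm /=.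
    by apply: big1 => i _; rewrite mulr0.
  by rewrite D ltnW.
rewrite !sumrB -!mulr_sumr XE !D ltn_ord ltnS leqnn /=.
rewrite rmorphB rmorph_nat -/T.
clear X XE entry; rewrite /d.
move: (nat_of_ord j) (leq_ord j) => k km; have Wk := wrec k.
have [k0|k0] := eqVneq k 0%N; have [kM|kM] := eqVneq k m.
- by move: m2; rewrite -kM k0.
- have -> : (k < m)%N by lia.
  by rewrite Wk k0 w0 /= mulr0n mulr1n; ring.
- rewrite kM ltnn /= mulr0n mulr1n; move: Wk; rewrite kM wn => Wk.
  have -> : beta * 1 * w 1%N = T * w m.+1 - w m by rewrite -Wk; ring.
  by ring.
- have -> : (k < m)%N by lia.
  by rewrite Wk /= mulr0n; ring.
Qed.

(** * Sorting the eigenvalues *)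

(** n distinct roots exhaust the n roots counted with multiplicity. *)
Lemma eigenvalues_unique (R : realType) (n : nat) (A : 'M[R[i]]_n) (s : seq R) :
  A \is hermsymmx -> sorted <%R s -> size s = n ->
  {in s, forall x, root (char_poly A) (x%:C)%C} -> eigenvalues A = s.
Proof.
move=> Ah s_lt sn sroot; have cE := eigenvaluesP Ah.
have s_uniq : uniq s by apply: sorted_uniq s_lt; [exact: lt_trans|exact: ltxx].
have e_size : size (eigenvalues A) = n.
  have := size_char_poly A; rewrite cE size_prod_XsubC => -[].
  by [].
have sub : {subset s <= eigenvalues A}.
  move=> x /sroot; rewrite cE -(big_map (fun x : R => (x%:C)%C) xpredT
    (fun z => 'X - z%:P)) root_prod_XsubC => /mapP[y ye xy].
  by have -> : x = y by exact: complexI xy.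
have [_ eqi] := uniq_min_size s_uniq sub (eq_leq (etrans e_size (esym sn))).
have e_uniq : uniq (eigenvalues A).
  by apply: leq_size_uniq s_uniq sub _; rewrite e_size sn.
apply: (sorted_eq (@le_trans _ R) (@le_anti _ R)).
- by apply: sort_sorted; exact: le_total.
- by apply: sub_sorted s_lt; exact: ltW.
- by apply: uniq_perm => // x; rewrite -eqi.
Qed.

Lemma lambda_unique (R : realType) (alpha : R[i]) (n : nat) (f : nat -> R) :
  (forall i, (i.+1 < n)%N -> f i < f i.+1) ->
  (forall i, (i < n)%N -> root (char_poly (Amx alpha n)) ((f i)%:C)%C) ->
  forall j, (j < n)%N -> lambda alpha n j.+1 = f j.
Proof.
move=> f_lt f_root j jn.
rewrite /lambda (@eigenvalues_unique _ _ _ (mkseq f n)) ?size_mkseq //.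
- by rewrite nth_mkseq.
- exact: Amx_hermitian.
- apply/(sortedP 0) => i; rewrite size_mkseq => i_lt.
  by rewrite !nth_mkseq ?f_lt // ltnW.
- by move=> x /mapP[k]; rewrite mem_iota add0n => /andP[_ k_lt] ->; exact: f_root.
Qed.

(** * The phase and its derivative *)

(** The third condition holds for A = a^2 - 1, B = a^2 + 1 and |p| <= 2 a.  It
    keeps the radicand in [phase_arg], and the derivative of the implicit equation
    of the phase, away from 0. *)
Definition phase_adm (R : realType) (A B p : R) : Prop :=
  [/\ 0 < A, 0 < B & A ^+ 2 + p ^+ 2 <= B ^+ 2].

Definition phase_arg (R : realType) (A B p x : R) : R :=
  (A * cot x + Num.sqrt (A ^+ 2 * cot x ^+ 2 + (B ^+ 2 - p ^+ 2))) / (B + p).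

(** The common form of eta_j for both parities of j, see [eta_phase]: inverting
    the argument of the arctangent for odd j amounts to changing the sign of p. *)
Definition phase (R : realType) (A B p x : R) : R :=
  - 2 * atan (phase_arg A B p x).

(** With H(x, y) = A sin y cos x - B cos y sin x + p sin x, this is - H_x at
    y = phase x, and [phase_den] is H_y. *)
Definition phase_num (R : realType) (A B p x : R) : R :=
  A * sin (phase A B p x) * sin x + (B * cos (phase A B p x) - p) * cos x.

Definition phase_den (R : realType) (A B p x : R) : R :=
  A * cos (phase A B p x) * cos x + B * sin (phase A B p x) * sin x.

Lemma phase_adm_p (R : realType) (A B p : R) : phase_adm A B p ->
  [/\ - B < p, p < B & `|p| <= B].
Proof.
move=> [A0 B0 AB]; suff h : `|p| < B.
  by move: (h); rewrite ltr_norml => /andP[? ?]; split=> //; exact: ltW.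
by rewrite -ltr_sqr ?nnegrE ?normr_ge0 ?ltW // real_normK ?num_real //; nra.
Qed.

Lemma cos_double_atan (R : realType) (w : R) :
  cos (- 2 * atan w) = (1 - w ^+ 2) / (1 + w ^+ 2).
Proof.
have w0 : 0 < 1 + w ^+ 2 by rewrite ltr_pwDl ?sqr_ge0.
rewrite mulNr cosN mulrC -[2]/(1 + 1) mulrDr mulr1 cosD.
have c2 : cos (atan w) ^+ 2 = (1 + w ^+ 2)^-1.
  by rewrite cos_atan exprVn sqr_sqrtr ?ltW.
have s2 : sin (atan w) ^+ 2 = 1 - (1 + w ^+ 2)^-1 by rewrite sin2cos2 c2.
by rewrite -!expr2 c2 s2; field; rewrite gt_eqF.
Qed.

Lemma sin_double_atan (R : realType) (w : R) :
  sin (- 2 * atan w) = - 2 * w / (1 + w ^+ 2).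
Proof.
have w0 : 0 < 1 + w ^+ 2 by rewrite ltr_pwDl ?sqr_ge0.
rewrite mulNr sinN mulrC -[2 in LHS]/(1 + 1) mulrDr mulr1 sinD.
have c2 : cos (atan w) ^+ 2 = (1 + w ^+ 2)^-1.
  by rewrite cos_atan exprVn sqr_sqrtr ?ltW.
have c0 : cos (atan w) != 0.
  by rewrite -sqrf_eq0 c2 invr_eq0 gt_eqF.
have -> : sin (atan w) = w * cos (atan w).
  by rewrite -[X in X * _](atanK w) /tan divfK.
rewrite [LHS](_ : _ = - 2 * w * cos (atan w) ^+ 2); last by ring.
by rewrite c2.
Qed.

(** The argument w of the arctangent is the positive root of a quadratic
    equation whose roots have opposite signs. *)
Lemma phase_argP (R : realType) (A B p x : R) : phase_adm A B p ->
  let w := phase_arg A B p x in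
  let S := Num.sqrt (A ^+ 2 * cot x ^+ 2 + (B ^+ 2 - p ^+ 2)) in
  [/\ 0 < w, 0 < S, S = (B + p) * w - A * cot x &
      (B + p) * w ^+ 2 - 2 * A * cot x * w - (B - p) = 0].
Proof.
move=> adm w S; have [p1 p2 _] := phase_adm_p adm; have [A0 B0 AB] := adm.
have Bp : 0 < B + p by lra.
have rad : (A * cot x) ^+ 2 < A ^+ 2 * cot x ^+ 2 + (B ^+ 2 - p ^+ 2).
  by rewrite exprMn ltrDl; nra.
have S0 : 0 < S by rewrite sqrtr_gt0 (le_lt_trans _ rad) ?sqr_ge0.
have S2 : S ^+ 2 = A ^+ 2 * cot x ^+ 2 + (B ^+ 2 - p ^+ 2).
  by rewrite sqr_sqrtr // ltW // (le_lt_trans _ rad) ?sqr_ge0.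
have wE : (B + p) * w = A * cot x + S.
  by rewrite /w /phase_arg mulrC divfK // gt_eqF.
have SA : `|A * cot x| < S.
  by rewrite -ltr_sqr ?nnegrE ?normr_ge0 ?ltW // real_normK ?num_real // S2.
have w0 : 0 < (B + p) * w.
  by rewrite wE; move: SA; rewrite ltr_norml => /andP[? ?]; lra.
split=> //; first by rewrite -(pmulr_rgt0 _ Bp).
  by rewrite wE; ring.
apply: (mulfI (lt0r_neq0 Bp)); rewrite mulr0.
have -> : (B + p) * ((B + p) * w ^+ 2 - 2 * A * cot x * w - (B - p)) =
  ((B + p) * w) ^+ 2 - 2 * A * cot x * ((B + p) * w) - (B ^+ 2 - p ^+ 2) by ring.
have -> : B ^+ 2 - p ^+ 2 = S ^+ 2 - A ^+ 2 * cot x ^+ 2 by rewrite S2; ring.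
by rewrite wE; ring.
Qed.

Lemma phase_bound (R : realType) (A B p x : R) : phase_adm A B p ->
  - pi < phase A B p x < 0.
Proof.
move=> adm; have [w0 _ _ _] := phase_argP x adm.
have := atan_ltpi2 (phase_arg A B p x); have := lt_atan w0; rewrite atan0.
by rewrite /phase => *; apply/andP; split; lra.
Qed.

(** Writing sin and cos of the phase in terms of the half-angle tangent - w
    turns the quadratic equation of [phase_argP] into H(x, phase x) = 0. *)
Lemma phase_eq (R : realType) (A B p x : R) : phase_adm A B p -> sin x != 0 ->
  A * sin (phase A B p x) * cos x - B * cos (phase A B p x) * sin x
    + p * sin x = 0.
Proof.
move=> adm sx; have [w0 _ _ wE] := phase_argP x adm.
rewrite /phase sin_double_atan cos_double_atan.
move: (phase_arg A B p x) w0 wE => w w0; rewrite /cot => wE.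
have w2 : 1 + w ^+ 2 != 0 by rewrite gt_eqF // ltr_pwDl ?sqr_ge0.
transitivity (sin x / (1 + w ^+ 2) *
  ((B + p) * w ^+ 2 - 2 * A * (cos x / sin x) * w - (B - p))).
  by field; rewrite sx w2.
by rewrite wE mulr0.
Qed.

(** (A cos n cos x + B sin n sin x)^2 + (A sin n cos x - B cos n sin x)^2 equals
    A^2 cos^2 x + B^2 sin^2 x, and by [phase_eq] the second square is
    (p sin x)^2; finally B^2 - p^2 >= A^2. *)
Lemma phase_den_ge (R : realType) (A B p x : R) :
  phase_adm A B p -> sin x != 0 -> A <= `|phase_den A B p x|.
Proof.
move=> adm sx; have [A0 B0 AB] := adm.
have E := phase_eq adm sx.
rewrite -ler_sqr ?nnegrE ?normr_ge0 ?(ltW A0) // real_normK ?num_real //.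
rewrite /phase_den; move: E; set n := phase A B p x => E.
have C := cos2Dsin2 n; have D := cos2Dsin2 x.
have -> : (A * cos n * cos x + B * sin n * sin x) ^+ 2 =
  (A ^+ 2 * cos x ^+ 2 + B ^+ 2 * sin x ^+ 2) * (cos n ^+ 2 + sin n ^+ 2)
  - (A * sin n * cos x - B * cos n * sin x + p * sin x - p * sin x) ^+ 2 by ring.
rewrite E C sub0r mulr1.
have -> : cos x ^+ 2 = 1 - sin x ^+ 2 by rewrite -D; ring.
have : 0 <= sin x ^+ 2 * (B ^+ 2 - (A ^+ 2 + p ^+ 2)).
  by rewrite mulr_ge0 ?sqr_ge0 // subr_ge0.
by lra.
Qed.

Lemma is_derive_cot (R : realType) (x : R) : sin x != 0 ->
  is_derive x 1 (@cot R) (- (sin x) ^- 2).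
Proof.
move=> sx; rewrite /cot.
have dV := is_deriveV sx (is_derive_sin x).
apply: is_derive_eq.
rewrite /GRing.scale /=.
rewrite [RHS](_ : _ = - (cos x ^+ 2 + sin x ^+ 2) / sin x ^+ 2); last first.
  by rewrite cos2Dsin2 mulN1r.
by field.
Qed.

(** The chain rule gives the derivative 2 A w / ((1 + w^2) S sin^2 x), which
    looks singular at 0 and pi.  By [phase_eq] it equals the quotient in the
    statement, both terms of which are polynomial in sines and cosines. *)
Lemma phase_derive (R : realType) (A B p x : R) : phase_adm A B p ->
  sin x != 0 ->
  is_derive x 1 (phase A B p) (phase_num A B p x / phase_den A B p x).
Proof.
move=> adm sx; have [p1 p2 _] := phase_adm_p adm; have [A0 B0 AB] := adm.
have [w0 S0 SE wE] := phase_argP x adm.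
have E := phase_eq adm sx.
have dcot := is_derive_cot sx.
set rad := (fun y => A ^+ 2 * cot y ^+ 2 + (B ^+ 2 - p ^+ 2)).
have drad : is_derive x 1 rad (- 2 * A ^+ 2 * cot x / sin x ^+ 2).
  by apply: is_derive_eq; rewrite /GRing.scale /=; field.
set S := Num.sqrt _ in S0 SE.
have rad0 : 0 < rad x by rewrite -sqrtr_gt0.
have dS : is_derive x 1 (Num.sqrt \o rad) ((2 * S)^-1 * (- 2 * A ^+ 2 * cot x / sin x ^+ 2)).
  by apply: is_derive1_comp; exact: is_derive1_sqrt.
set w := phase_arg A B p x in w0 SE wE.
have dw : is_derive x 1 (phase_arg A B p) (- A * w / (S * sin x ^+ 2)).
  rewrite /phase_arg -/(rad _) -[fun _ => _]/(fun y => (A * cot y + (Num.sqrt \o rad) y) / (B + p)).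
  apply: is_derive_eq.
  rewrite /GRing.scale /= mulr0 add0r.
  have -> : - A * w = - A * ((A * cot x + S) / (B + p)) by [].
  by field; rewrite sx (gt_eqF S0) /= gt_eqF //; lra.
have dn : is_derive x 1 (fun y => - 2 * (atan \o phase_arg A B p) y)
   (- 2 * ((1 + w ^+ 2)^-1 * (- A * w / (S * sin x ^+ 2)))).
  by apply: is_derive_eq.
apply: is_derive_eq.
have w2 : 1 + w ^+ 2 != 0 by rewrite gt_eqF // ltr_pwDl ?sqr_ge0.
have denE : phase_den A B p x = - (S * sin x).
  rewrite /phase_den /phase cos_double_atan sin_double_atan -/w.
  apply/eqP; rewrite -subr_eq0; apply/eqP.
  transitivity (w * sin x / (1 + w ^+ 2) *
    ((B + p) * w ^+ 2 - 2 * A * cot x * w - (B - p))).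
    by rewrite SE /cot; field; rewrite sx w2.
  by rewrite wE mulr0.
have numE : phase_num A B p x = A * sin (phase A B p x) / sin x.
  apply: (mulIf sx); rewrite divfK // /phase_num.
  set n := phase A B p x in E *.
  transitivity (A * sin n * (cos x ^+ 2 + sin x ^+ 2)
    - cos x * (A * sin n * cos x - B * cos n * sin x + p * sin x)); first by ring.
  by rewrite E cos2Dsin2 mulr1 mulr0 subr0.
rewrite numE denE /phase sin_double_atan -/w.
by field; rewrite sx w2 gt_eqF.
Qed.

(** * Uniform bounds on the phase *)

(** The mean value theorem without an assumption on the order of x and y. *)
Lemma MVT_between (R : realType) (f df : R -> R) (x y : R) :
  (forall z, z \in `[Num.min x y, Num.max x y] -> is_derive z 1 f (df z)) ->
  exists2 z, z \in `[Num.min x y, Num.max x y] & f y - f x = df z * (y - x).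
Proof.
have seg (a b : R) : a <= b -> (forall z, z \in `[a, b] -> is_derive z 1 f (df z)) ->
    exists2 z, z \in `[a, b] & f b - f a = df z * (b - a).
  move=> ab H.
  have fc : {within `[a, b], continuous f}.
    by apply: derivable_within_continuous => z zab; have [] := H z zab.
  have H2 z : z \in `]a, b[ -> is_derive z 1 f (df z).
    by move=> zab; apply: H; move: zab; rewrite !in_itv /= => /andP[/ltW -> /ltW ->].
  by have [z zab E] := MVT_segment ab H2 fc; exists z.
have [xy|yx] := leP x y => H; first exact: seg.
have [z zI E] := seg _ _ (ltW yx) H; exists z => //.
by rewrite -opprB E -mulrN opprB.
Qed.

Lemma sin_lip (R : realType) (x y : R) : `|sin y - sin x| <= `|y - x|.
Proof.
have [z _ ->] := @MVT_between R sin cos x y (fun z _ => is_derive_sin z).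
by rewrite normrM ler_piMl // cos_max.
Qed.

Lemma cos_lip (R : realType) (x y : R) : `|cos y - cos x| <= `|y - x|.
Proof.
have [z _ ->] := @MVT_between R cos (fun z => - sin z) x y (fun z _ => is_derive_cos z).
by rewrite normrM normrN ler_piMl // sin_max.
Qed.

Lemma mulr_lip (R : realDomainType) (a b c d : R) : `|b| <= 1 -> `|c| <= 1 ->
  `|a * b - c * d| <= `|a - c| + `|b - d|.
Proof.
move=> b1 c1; have -> : a * b - c * d = (a - c) * b + c * (b - d) by ring.
rewrite (le_trans (ler_normD _ _)) // !normrM lerD //.
  by rewrite ler_piMr.
by rewrite ler_piMl.
Qed.

Definition dphase (R : realType) (A B p x : R) : R :=
  phase_num A B p x / phase_den A B p x.

Lemma sin_neq0_pi (R : realType) (x : R) : 0 < x < pi -> sin x != 0.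
Proof. by move=> xI; rewrite gt_eqF // sin_gt0_pi. Qed.

Lemma mulr_le1_norm (R : realDomainType) (a b : R) :
  `|a| <= 1 -> `|b| <= 1 -> `|a * b| <= 1.
Proof. by move=> a1 b1; rewrite normrM mulr_ile1. Qed.

Lemma itv_between (R : realType) (a b x y z : R) : a < x < b -> a < y < b ->
  z \in `[Num.min x y, Num.max x y] -> a < z < b /\ `|z - x| <= `|y - x|.
Proof.
move=> /andP[ax xb] /andP[ay yb]; rewrite in_itv /=.
case: (leP x y) => xy /andP[z1 z2].
  split; first by apply/andP; split; lra.
  by rewrite !ger0_norm ?subr_ge0 // lerD2r.
split; first by apply/andP; split; lra.
by rewrite !ler0_norm ?subr_le0 ?(ltW xy) // lerN2 lerD2r.
Qed.

Section PhaseBounds.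
Variables (R : realType) (A B p : R) (adm : phase_adm A B p).

Let M := A + 2 * B.
Let K := M / A.

Let A0 : 0 < A. Proof. by case: adm. Qed.
Let B0 : 0 < B. Proof. by case: adm. Qed.
Let pB : `|p| <= B. Proof. by case: (phase_adm_p adm). Qed.
Let M0 : 0 < M. Proof. by rewrite /M; move: A0 B0; lra. Qed.
Let K0 : 0 < K. Proof. by rewrite divr_gt0. Qed.

Lemma phase_num_bound x : `|phase_num A B p x| <= M.
Proof.
rewrite /phase_num; set n := phase A B p x.
have -> : A * sin n * sin x + (B * cos n - p) * cos x =
  A * (sin n * sin x) + B * (cos n * cos x) - p * cos x by ring.
have h1 : `|A * (sin n * sin x)| <= A.
  by rewrite normrM (gtr0_norm A0) ler_piMr ?(ltW A0) ?mulr_le1_norm ?sin_max.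
have h2 : `|B * (cos n * cos x)| <= B.
  by rewrite normrM (gtr0_norm B0) ler_piMr ?(ltW B0) ?mulr_le1_norm ?cos_max.
have h3 : `|p * cos x| <= B.
  by rewrite normrM (le_trans _ pB) // ler_piMr ?normr_ge0 ?cos_max.
rewrite (le_trans (ler_normB _ _)) // (le_trans (lerD (ler_normD _ _) (lexx _))) //.
rewrite /M; lra.
Qed.

Lemma phase_den_bound x : `|phase_den A B p x| <= M.
Proof.
rewrite /phase_den -!mulrA; set n := phase A B p x.
have h1 : `|A * (cos n * cos x)| <= A.
  by rewrite normrM (gtr0_norm A0) ler_piMr ?(ltW A0) ?mulr_le1_norm ?cos_max.
have h2 : `|B * (sin n * sin x)| <= B.
  by rewrite normrM (gtr0_norm B0) ler_piMr ?(ltW B0) ?mulr_le1_norm ?sin_max.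
rewrite (le_trans (ler_normD _ _)) // /M; move: B0; lra.
Qed.

Lemma dphase_bound x : 0 < x < pi -> `|dphase A B p x| <= K.
Proof.
move=> /sin_neq0_pi sx; have D := phase_den_ge adm sx.
rewrite /dphase normrM normfV ler_pM ?normr_ge0 ?invr_ge0 ?phase_num_bound //.
by rewrite lef_pV2 // posrE (lt_le_trans A0).
Qed.

Lemma phase_lip x y : 0 < x < pi -> 0 < y < pi ->
  `|phase A B p y - phase A B p x| <= K * `|y - x|.
Proof.
move=> xI yI; have [|z zI ->] := @MVT_between R (phase A B p) (dphase A B p) x y.
  move=> z /(itv_between xI yI)[/sin_neq0_pi sz _]; exact: phase_derive.
have [zpi _] := itv_between xI yI zI.
by rewrite normrM ler_wpM2r ?dphase_bound.
Qed.

Let N := M * (K + 1).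

Lemma phase_num_lip x y : 0 < x < pi -> 0 < y < pi ->
  `|phase_num A B p y - phase_num A B p x| <= N * `|y - x|.
Proof.
move=> xI yI; have L := phase_lip xI yI.
rewrite /phase_num; set m := phase A B p x in L *; set n := phase A B p y in L *.
have -> : A * sin n * sin y + (B * cos n - p) * cos y -
  (A * sin m * sin x + (B * cos m - p) * cos x) =
  A * (sin n * sin y - sin m * sin x) + B * (cos n * cos y - cos m * cos x)
   - p * (cos y - cos x) by ring.
have h1 : `|sin n * sin y - sin m * sin x| <= (K + 1) * `|y - x|.
  rewrite (le_trans (mulr_lip _ _ _ _)) ?sin_max // mulrDl mul1r lerD ?sin_lip //.
  exact: le_trans (sin_lip _ _) L.
have h2 : `|cos n * cos y - cos m * cos x| <= (K + 1) * `|y - x|.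
  rewrite (le_trans (mulr_lip _ _ _ _)) ?cos_max // mulrDl mul1r lerD ?cos_lip //.
  exact: le_trans (cos_lip _ _) L.
have h3 : `|p * (cos y - cos x)| <= B * ((K + 1) * `|y - x|).
  rewrite normrM ler_pM // (le_trans (cos_lip _ _)) // ler_peMl //.
  by move: K0; lra.
rewrite (le_trans (ler_normB _ _)) // (le_trans (lerD (ler_normD _ _) (lexx _))) //.
rewrite [N * _](_ : _ = A * ((K + 1) * `|y - x|) + B * ((K + 1) * `|y - x|)
  + B * ((K + 1) * `|y - x|)); last by rewrite /N /M; ring.
rewrite lerD // normrM [`|B * _|]normrM (gtr0_norm A0) (gtr0_norm B0).
by rewrite lerD // ler_pM2l.
Qed.

Lemma phase_den_lip x y : 0 < x < pi -> 0 < y < pi ->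
  `|phase_den A B p y - phase_den A B p x| <= N * `|y - x|.
Proof.
move=> xI yI; have L := phase_lip xI yI.
rewrite /phase_den; set m := phase A B p x in L *; set n := phase A B p y in L *.
have -> : A * cos n * cos y + B * sin n * sin y -
  (A * cos m * cos x + B * sin m * sin x) =
  A * (cos n * cos y - cos m * cos x) + B * (sin n * sin y - sin m * sin x) by ring.
have h1 : `|sin n * sin y - sin m * sin x| <= (K + 1) * `|y - x|.
  rewrite (le_trans (mulr_lip _ _ _ _)) ?sin_max // mulrDl mul1r lerD ?sin_lip //.
  exact: le_trans (sin_lip _ _) L.
have h2 : `|cos n * cos y - cos m * cos x| <= (K + 1) * `|y - x|.
  rewrite (le_trans (mulr_lip _ _ _ _)) ?cos_max // mulrDl mul1r lerD ?cos_lip //.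
  exact: le_trans (cos_lip _ _) L.
rewrite (le_trans (ler_normD _ _)) //.
rewrite [N * _](_ : _ = A * ((K + 1) * `|y - x|) + 2 * B * ((K + 1) * `|y - x|));
  last by rewrite /N /M; ring.
rewrite normrM [`|B * _|]normrM (gtr0_norm A0) (gtr0_norm B0).
rewrite lerD ?ler_pM2l // ler_pM ?(ltW B0) //; move: B0; lra.
Qed.

(** The second derivative is avoided: a quotient of bounded Lipschitz functions
    with denominator bounded below is Lipschitz.  The constant depends on A and
    B only, hence not on the parity of j. *)
Lemma dphase_lip x y : 0 < x < pi -> 0 < y < pi ->
  `|dphase A B p y - dphase A B p x| <= 2 * M * N / A ^+ 2 * `|y - x|.
Proof.
move=> xI yI; have Nl := phase_num_lip xI yI; have Dl := phase_den_lip xI yI.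
have Dx := phase_den_ge adm (sin_neq0_pi xI).
have Dy := phase_den_ge adm (sin_neq0_pi yI).
have Nx := phase_num_bound x; have Dbx := phase_den_bound x.
rewrite /dphase; move: Nl Dl Dx Dy Nx Dbx.
set nx := phase_num A B p x; set ny := phase_num A B p y.
set dx := phase_den A B p x; set dy := phase_den A B p y.
move=> Nl Dl Dx Dy Nx Dbx.
have dx0 : dx != 0 by rewrite -normr_gt0 (lt_le_trans A0).
have dy0 : dy != 0 by rewrite -normr_gt0 (lt_le_trans A0).
have -> : ny / dy - nx / dx = ((ny - nx) * dx - nx * (dy - dx)) / (dy * dx).
  by field; rewrite dx0 dy0.
rewrite normrM normfV mulrAC; apply: ler_pM; rewrite ?invr_ge0 //.
  rewrite (le_trans (ler_normB _ _)) // !normrM.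
  rewrite (_ : 2 * M * N * `|y - x| = N * `|y - x| * M + M * (N * `|y - x|)); last by ring.
  by rewrite lerD // ler_pM.
by rewrite lef_pV2 ?posrE ?exprn_gt0 ?normr_gt0 ?mulf_neq0 // normrM expr2 ler_pM // ltW.
Qed.

Lemma phase_taylor x y : 0 < x < pi -> 0 < y < pi ->
  `|phase A B p y - phase A B p x - dphase A B p x * (y - x)| <=
  2 * M * N / A ^+ 2 * `|y - x| ^+ 2.
Proof.
move=> xI yI; have [|z zI ->] := @MVT_between R (phase A B p) (dphase A B p) x y.
  move=> z /(itv_between xI yI)[/sin_neq0_pi sz _]; exact: phase_derive.
have [zpi zx] := itv_between xI yI zI.
rewrite -mulrBl normrM [in leRHS]expr2 mulrA ler_wpM2r //.
rewrite (le_trans (dphase_lip xI zpi)) // ler_wpM2l //.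
by rewrite divr_ge0 ?sqr_ge0 // /N !mulr_ge0 ?(ltW M0) ?addr_ge0 ?(ltW K0).
Qed.

End PhaseBounds.

(** * Second-order expansion of g *)

Lemma gE (R : realType) (x : R) : g x = 2 - 2 * cos x.
Proof.
have -> : cos x = cos (x / 2 + x / 2) by congr cos; field.
by rewrite /g cosD -!expr2 cos2sin2; ring.
Qed.

Lemma derive1_g (R : realType) : derive1 (@g R) = fun x => 2 * sin x.
Proof.
have -> : @g R = fun x => 2 - 2 * cos x by apply/funext => x; exact: gE.
apply/funext => x; rewrite derive1E; apply: derive_val.
by apply: is_derive_eq; rewrite /GRing.scale /=; ring.
Qed.

Lemma derive1n2_g (R : realType) : derive1n 2 (@g R) = fun x => 2 * cos x.
Proof.
rewrite derive1nS derive1n1 derive1_g.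
by apply/funext => x; rewrite derive1E; apply: derive_val.
Qed.

Lemma norm_between0 (R : realType) (z x : R) :
  z \in `[Num.min 0 x, Num.max 0 x] -> `|z| <= `|x|.
Proof.
rewrite in_itv /=; case: (leP 0 x) => x0 /andP[z1 z2].
  by rewrite !ger0_norm // (le_trans z1).
by rewrite !ler0_norm ?(ltW x0) // lerN2.
Qed.

Lemma cos_sub1_le (R : realType) (x : R) : `|cos x - 1| <= `|x| ^+ 2.
Proof.
have [z zI] := @MVT_between R cos (fun z => - sin z) 0 x (fun z _ => is_derive_cos z).
rewrite cos0 subr0 => ->; rewrite normrM normrN expr2 ler_wpM2r //.
by have := sin_lip 0 z; rewrite sin0 !subr0 => /le_trans -> //; exact: norm_between0.
Qed.

(** The square bound is weaker near 0, but it is the one that integrates to the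
    cubic remainder of [cos_taylor2_le]. *)
Lemma sin_sub_le (R : realType) (x : R) :
  `|sin x - x| <= `|x| ^+ 2 /\ `|sin x - x| <= `|x| ^+ 3.
Proof.
have [z zI] : exists2 z, z \in `[Num.min 0 x, Num.max 0 x] &
    sin x - x - (sin 0 - 0) = (cos z - 1) * (x - 0).
  exact: (@MVT_between R (fun y => sin y - y) (fun y => cos y - 1)).
have zx := norm_between0 zI.
rewrite sin0 !subr0 => ->; rewrite normrM; split.
  rewrite expr2 ler_wpM2r //.
  by have := cos_lip 0 z; rewrite cos0 subr0 => /le_trans ->.
by rewrite exprSr ler_wpM2r // (le_trans (cos_sub1_le z)) // lerXn2r ?nnegrE.
Qed.

Lemma cos_taylor2_le (R : realType) (x : R) :
  `|cos x - 1 + x ^+ 2 / 2| <= `|x| ^+ 3.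
Proof.
have [z zI] : exists2 z, z \in `[Num.min 0 x, Num.max 0 x] &
    cos x - 1 + x ^+ 2 / 2 - (cos 0 - 1 + 0 ^+ 2 / 2) = (z - sin z) * (x - 0).
  apply: (@MVT_between R (fun y => cos y - 1 + y ^+ 2 / 2)
    (fun y => y - sin y)) => z _.
  by apply: is_derive_eq; rewrite /GRing.scale /=; field.
rewrite cos0 subrr expr0n /= mul0r addr0 !subr0 => ->.
rewrite normrM exprSr ler_wpM2r // distrC.
have [h _] := sin_sub_le z; rewrite (le_trans h) // lerXn2r ?nnegrE //.
exact: norm_between0.
Qed.

(** Here r = 1/n, x = t + r e(x), e1 = e(t), e2 = e(x) and d = e'(t).  With
    h = x - t, the Lipschitz bound gives h = r e1 + O(r^2); inserting this in
    h = r (e1 + d h + O(h^2)) gives h = r e1 + r^2 e1 d + O(r^3).  The result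
    follows from 2 cos t - 2 cos x = 2 h sin t + h^2 cos t + O(h^3). *)
Lemma perturbed_expansion (R : realType) (E K L r t x e1 e2 d : R) :
  0 <= E -> 0 <= K -> 0 <= L -> 0 <= r ->
  `|e1| <= E -> `|e2| <= E -> `|d| <= K ->
  x = t + r * e2 -> `|e2 - e1| <= K * `|x - t| ->
  `|e2 - e1 - d * (x - t)| <= L * `|x - t| ^+ 2 ->
  `|2 * cos t - 2 * cos x - (2 * sin t * e1 * r
     + (2 * sin t * e1 * d + 1 / 2 * (2 * cos t) * e1 ^+ 2) * r ^+ 2)|
  <= (2 * (K ^+ 2 * E + L * E ^+ 2) + 2 * K * E ^+ 2 + 4 * E ^+ 3) * r ^+ 3.
Proof.
move=> E0 K0 L0 r0 e1E e2E dK xE lip tay.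
set h := x - t in lip tay.
have hE : h = r * e2 by rewrite /h xE; ring.
have hb : `|h| <= E * r by rewrite hE normrM (ger0_norm r0) mulrC ler_wpM2r.
have h2 : `|h| ^+ 2 <= (E * r) ^+ 2 by rewrite lerXn2r ?nnegrE ?mulr_ge0.
have h3 : `|h| ^+ 3 <= (E * r) ^+ 3 by rewrite lerXn2r ?nnegrE ?mulr_ge0.
set d1 := e2 - e1 in lip tay; set rho := d1 - d * h in tay.
have d1b : `|d1| <= K * (E * r) by rewrite (le_trans lip) // ler_wpM2l.
have rhob : `|rho| <= L * (E * r) ^+ 2 by rewrite (le_trans tay) // ler_wpM2l.
have cxE : cos x = cos t * cos h - sin t * sin h.
  by rewrite -cosD; congr cos; rewrite /h; ring.
rewrite cxE.
have [_ sh] := sin_sub_le h; have ch := cos_taylor2_le h.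
set a := sin h - h in sh; set b := cos h - 1 + h ^+ 2 / 2 in ch.
have -> : 2 * cos t - 2 * (cos t * cos h - sin t * sin h) - (2 * sin t * e1 * r
     + (2 * sin t * e1 * d + 1 / 2 * (2 * cos t) * e1 ^+ 2) * r ^+ 2) =
  sin t * (2 * (r ^+ 2 * d * d1 + r * rho)) + cos t * (r * d1 * (h + r * e1))
   - 2 * (cos t * b - sin t * a).
  by rewrite /a /b /rho /d1 hE; field.
have m1 (u v w : R) : `|u| <= 1 -> `|v| <= w -> `|u * v| <= w.
  by move=> u1 vw; rewrite normrM (le_trans _ vw) // ler_piMl.
have A1 : `|2 * (r ^+ 2 * d * d1 + r * rho)| <=
    2 * (r ^+ 2 * K * (K * (E * r)) + r * (L * (E * r) ^+ 2)).
  rewrite normrM (@ger0_norm _ 2) // ler_wpM2l //.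
  rewrite (le_trans (ler_normD _ _)) // lerD // !normrM ?normrX (ger0_norm r0).
    by rewrite ler_pM ?mulr_ge0 // -expr2 ler_wpM2l ?exprn_ge0.
  by rewrite ler_wpM2l.
have A2 : `|r * d1 * (h + r * e1)| <= r * (K * (E * r)) * (2 * (E * r)).
  rewrite !normrM (ger0_norm r0) ler_pM ?mulr_ge0 ?ler_wpM2l //.
  rewrite (le_trans (ler_normD _ _)) //.
  rewrite (_ : 2 * (E * r) = E * r + r * E); last by ring.
  by rewrite lerD // normrM (ger0_norm r0) ler_wpM2l.
have A3 : `|2 * (cos t * b - sin t * a)| <= 2 * ((E * r) ^+ 3 + (E * r) ^+ 3).
  rewrite normrM (@ger0_norm _ 2) // ler_wpM2l //.
  rewrite (le_trans (ler_normB _ _)) // lerD // m1 ?cos_max ?sin_max //.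
    exact: le_trans ch h3.
  exact: le_trans sh h3.
rewrite (le_trans (ler_normB _ _)) //.
rewrite (le_trans (lerD (ler_normD _ _) A3)) //.
rewrite (le_trans (lerD (lerD (m1 _ _ _ (sin_max _) A1)
  (m1 _ _ _ (cos_max _) A2)) (lexx _))) //.
by rewrite le_eqVlt; apply/orP; left; apply/eqP; ring.
Qed.

(** * Quantization of the inner eigenvalues *)

Lemma sin_cos_addnpi (R : realType) (j : nat) (y : R) :
  sin (j%:R * pi + y) = (-1) ^+ j * sin y /\
  cos (j%:R * pi + y) = (-1) ^+ j * cos y.
Proof.
elim: j => [|j [IHs IHc]]; first by rewrite mul0r add0r expr0 !mul1r.
have -> : j.+1%:R * pi + y = j%:R * pi + y + pi by rewrite mulrSr; ring.
by rewrite sinDpi cosDpi IHs IHc exprS; split; ring.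
Qed.

(** Throughout, p j = (-1)^j 2 Re alpha, so that H(x, y) = 0 is the
    spectral equation once n x = j pi + y. *)
Section Eta.
Variables (R : realType) (alpha : R[i]) (a1 : 1 < cmod alpha).

Let A := cmod alpha ^+ 2 - 1.
Let B := cmod alpha ^+ 2 + 1.
Let p (j : nat) : R := (-1) ^+ j * (2 * complex.Re alpha).

Lemma cmodE (z : R[i]) : cmod z ^+ 2 = complex.Re z ^+ 2 + complex.Im z ^+ 2.
Proof. by case: z => x y; rewrite /cmod /= sqr_sqrtr // addr_ge0 ?sqr_ge0. Qed.

Lemma cmod_addE : cmod (1 + alpha) ^+ 2 = B + 2 * complex.Re alpha.
Proof. by rewrite /B !cmodE; case: (alpha) => x y /=; ring. Qed.

Lemma cmod_subE : cmod (1 - alpha) ^+ 2 = B - 2 * complex.Re alpha.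
Proof. by rewrite /B !cmodE; case: (alpha) => x y /=; ring. Qed.

Let p_sqr j : p j ^+ 2 = 4 * complex.Re alpha ^+ 2.
Proof. by rewrite /p [LHS]exprMn sqrr_sign; ring. Qed.

(** B^2 - A^2 = 4 |alpha|^2 >= 4 (Re alpha)^2 = p^2. *)
Lemma eta_adm j : phase_adm A B (p j).
Proof.
have a2 : 1 < cmod alpha ^+ 2 by rewrite exprn_egt1.
split; rewrite /A /B; [by lra| by lra|].
rewrite p_sqr cmodE.
have := sqr_ge0 (complex.Im alpha); nra.
Qed.

Lemma eta_phase (j : nat) : eta alpha j%:Z = phase A B (p j).
Proof.
apply/funext => x; have adm := eta_adm j.
have [w0 S0 SE wE] := phase_argP x adm; have [p1 p2 _] := phase_adm_p adm.
have [A0 B0 AB] := adm.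
have D0 := eta_adm 0; have [d1 d2 _] := phase_adm_p D0.
rewrite /p expr0 mul1r in d1 d2.
set d := B + 2 * complex.Re alpha; set e := B - 2 * complex.Re alpha.
have d0 : 0 < d by rewrite /d; lra.
have e0 : 0 < e by rewrite /e; lra.
have kE : k_ alpha = - A / d by rewrite /k_ cmod_addE -/d /A; congr (_ / _); ring.
have lE : l_ alpha ^+ 2 = e / d by rewrite /l_ exprMn exprVn cmod_addE cmod_subE.
rewrite /eta /phase; congr (_ * atan _); rewrite /phase_arg.
set S := Num.sqrt (A ^+ 2 * _ + _) in S0 SE *.
have S2 : S ^+ 2 = A ^+ 2 * cot x ^+ 2 + d * e.
  rewrite sqr_sqrtr; last by rewrite ltW // -sqrtr_gt0.
  by rewrite p_sqr /d /e; ring.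
clear w0 SE wE; clearbody S; move: (cot x) S2 => ct S2.
have -> : Num.sqrt (k_ alpha ^+ 2 * ct ^+ 2 + l_ alpha ^+ 2) = S / d.
  rewrite -[RHS]ger0_norm ?divr_ge0 ?ltW // -sqrtr_sqr; congr Num.sqrt.
  by rewrite kE lE !expr_div_n S2; field; rewrite gt_eqF.
have -> : (-1) ^ (j%:Z + 1) = (-1) ^+ j.+1 :> R.
  by rewrite -[LHS]/((-1) ^ (j%:Z + 1%N%:Z)) -PoszD addn1.
rewrite kE /p -[(-1) ^ j%:Z]/((-1) ^+ j) -(signr_odd _ j) -(signr_odd _ j) -(signr_odd _ j.+1) /=.
case: (odd j); rewrite /= ?expr0 ?expr1 ?expr1z ?mul1r; last first.
  rewrite -/d; field; rewrite gt_eqF //.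
rewrite mulN1r -/e exprN1.
(* For odd j the base of the power -1 is (S - A ct) / d, and this identity
   rationalizes its inverse. *)
have dE : d * e = (A * ct + S) * (S - A * ct) by ring: S2.
have nz : S - A * ct != 0.
  apply/eqP => z; have := mulr_gt0 d0 e0; rewrite dE z mulr0 ltxx //.
have -> : - A / d * ct + S / d = (S - A * ct) / d by ring.
rewrite invf_div.
apply: (mulIf nz); rewrite mulfVK //; apply: (mulIf (lt0r_neq0 e0)).
rewrite dE; field; rewrite gt_eqF //.
Qed.

(** sin (n x) and cos (n x) are (-1)^j times the sine and cosine of the phase,
    so the spectral equation is, up to sign, the one of [phase_eq]. *)
Lemma eta_root (m j : nat) (x : R) : 0 < x < pi ->
  m.+1%:R * x = j%:R * pi + eta alpha j%:Z x ->
  chebU (2 * cos x) m.+2 - cmod alpha ^+ 2 * chebU (2 * cos x) m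
   = 2 * complex.Re alpha.
Proof.
move=> xI xE; have sx := sin_neq0_pi xI.
have E := phase_eq (eta_adm j) sx.
apply: (mulfI sx); rewrite mulrBr mulrCA !chebU_sin.
have -> : m.+2%:R * x = m.+1%:R * x + x by rewrite [m.+2%:R]mulrSr; ring.
have -> : m%:R * x = m.+1%:R * x - x by rewrite [m.+1%:R]mulrSr; ring.
rewrite xE eta_phase sinB sinD; set n := phase A B (p j) x in E *.
have [-> ->] := sin_cos_addnpi j n.
have sg : (-1) ^+ j * (-1) ^+ j = 1 :> R by rewrite -expr2 sqrr_sign.
transitivity ((-1) ^+ j * (p j * sin x - (A * sin n * cos x - B * cos n * sin x + p j * sin x))).
  by rewrite /A /B; ring.
by rewrite E subr0 /p !mulrA sg; ring.
Qed.

(** n x - eta x - j pi is negative at (j-1) pi / n, where it equals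
    - pi - eta, and positive at j pi / n, where it equals - eta.  For
    2 <= j <= n-1 both ends lie strictly between 0 and pi. *)
Lemma eta_fixpoint (n j : nat) : (2 <= j <= n.-1)%N ->
  exists2 x : R, j.-1%:R * pi / n%:R < x < j%:R * pi / n%:R &
    n%:R * x = j%:R * pi + eta alpha j%:Z x.
Proof.
move=> jn; have n0 : 0 < n%:R :> R by rewrite ltr0n; lia.
have p0 := pi_gt0 R.
have j1 : j.-1%:R = j%:R - 1 :> R by rewrite -subn1 natrB //; lia.
have j2 : 2 <= j%:R :> R by rewrite (ler_nat R 2); lia.
have j3 : j%:R + 1 <= n%:R :> R by rewrite natr1 ler_nat; lia.
rewrite eta_phase.
set a := _ / _; set b := _ / _.
have aE : n%:R * a = j%:R * pi - pi by rewrite /a j1; field; rewrite gt_eqF.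
have bE : n%:R * b = j%:R * pi by rewrite /b; field; rewrite gt_eqF.
have a0 : 0 < a by rewrite /a divr_gt0 // mulr_gt0 // j1; lra.
have bp : b < pi.
  by rewrite -(ltr_pM2l n0) bE ltr_pM2r //; lra.
have ab : a < b by rewrite -(ltr_pM2l n0) aE bE; lra.
pose f y := n%:R * y - phase A B (p j) y.
have fc : {within `[a, b], continuous f}.
  apply: derivable_within_continuous => y; rewrite in_itv /= => /andP[ay yb].
  have sy : sin y != 0 by apply: sin_neq0_pi; rewrite (lt_le_trans a0) ?(le_lt_trans yb).
  have := phase_derive (eta_adm j) sy => -[dP _].
  by apply: derivableB.
have /andP[ea1 ea2] := phase_bound a (eta_adm j).
have /andP[eb1 eb2] := phase_bound b (eta_adm j).
have fa : f a < j%:R * pi by rewrite /f aE; lra.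
have fb : j%:R * pi < f b by rewrite /f bE; lra.
have [|x] := @IVT R f a b (j%:R * pi) (ltW ab) fc.
  by rewrite ge_min le_max (ltW fa) (ltW fb) orbT.
rewrite in_itv /= => /andP[ax xb] fx; exists x; last by rewrite -fx /f; ring.
rewrite !lt_neqAle ax xb !andbT; apply/andP; split.
  by apply: contraTneq fa => ->; rewrite fx ltxx.
by apply: contraTneq fb => <-; rewrite fx ltxx.
Qed.

End Eta.

(** * The outer roots *)

Lemma bernoulli (R : realDomainType) (x : R) n : -1 <= x ->
  1 + n%:R * x <= (1 + x) ^+ n.
Proof.
move=> x1; elim: n => [|n IH]; first by rewrite mul0r addr0 expr0.
have x0 : 0 <= 1 + x by lra.
have n0 : 0 <= n%:R :> R by [].
rewrite exprS mulrSr; have := ler_wpM2l x0 IH.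
have := mulr_ge0 n0 (sqr_ge0 x); lra.
Qed.

(** Bernoulli's inequality for the square root b of a gives
    a^n >= (n (b - 1))^2. *)
Lemma near_natM_expV_le (R : realType) (a eps : R) : 1 < a -> 0 < eps ->
  \forall n \near \oo, n%:R / a ^+ n <= eps.
Proof.
move=> a1 e0; have a0 : 0 < a by lra.
set b := Num.sqrt a.
have b2 : b ^+ 2 = a by rewrite sqr_sqrtr // ltW.
have b0 : 0 <= b by rewrite sqrtr_ge0.
have b1 : 1 < b.
  by rewrite -ltr_sqr ?nnegrE // expr1n b2.
have c0 : 0 < eps * (b - 1) ^+ 2 by rewrite mulr_gt0 // exprn_gt0 // subr_gt0.
near=> n.
have nb : (eps * (b - 1) ^+ 2)^-1 <= n%:R by near: n; exact: nbhs_infty_ger.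
have n0 : 0 < n%:R :> R by rewrite (lt_le_trans _ nb) // invr_gt0.
have bn : n%:R * (b - 1) <= b ^+ n.
  have b1' : -1 <= b - 1 by lra.
  have := bernoulli n b1'; rewrite (_ : 1 + (b - 1) = b); last by ring.
  by lra.
have bn2 : (n%:R * (b - 1)) ^+ 2 <= a ^+ n.
  rewrite -b2 exprAC lerXn2r ?nnegrE ?exprn_ge0 // mulr_ge0 //; lra.
rewrite ler_pdivrMr ?exprn_gt0 // (le_trans _ (ler_wpM2l (ltW e0) bn2)) //.
rewrite (_ : eps * _ = n%:R * (n%:R * (eps * (b - 1) ^+ 2))); last by ring.
rewrite ler_peMr // ?(ltW n0) //.
by rewrite -ler_pdivrMr // div1r.
Unshelve. all: by end_near. Qed.

(** With n = m + 1, the equation times r - 1/r is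
      P(r) = r^m (r^2 - a^2) + err(r) = 0,  |err| <= 6 a^2 on (1, 2a].
    With d = 13 a^2 / a^n, that is a^m d = 13 a, the main term at a + d is at
    least 2 a d a^m = 26 a^2.  At a - d it is at most - a d (a - d)^m, and
    (a - d)^m >= a^m / 2 by Bernoulli once m d <= a / 2; so it is at most
    - 13/2 a^2. *)
Lemma outer_root (R : realType) (a : R) : 1 < a ->
  \forall n \near \oo, forall c : R, `|c| <= a ->
    exists2 r : R, 1 < r /\ `|r - a| <= 13 * a ^+ 2 / a ^+ n &
      chebU (r + r^-1) n.+1 - a ^+ 2 * chebU (r + r^-1) n.-1 = 2 * c.
Proof.
move=> a1; have a0 : 0 < a by lra.
(* Makes n d <= a / 2, and n d <= (a - 1) / 2 so that a - d > 1. *)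
pose eps := Num.min ((26 * a) ^-1) ((a - 1) / (26 * a ^+ 2)).
have eps0 : 0 < eps.
  by rewrite lt_min invr_gt0 divr_gt0 ?mulr_gt0 ?exprn_gt0 //; lra.
suff main n : (1 <= n)%N -> n%:R / a ^+ n <= eps -> forall c : R, `|c| <= a ->
    exists2 r : R, 1 < r /\ `|r - a| <= 13 * a ^+ 2 / a ^+ n &
      chebU (r + r^-1) n.+1 - a ^+ 2 * chebU (r + r^-1) n.-1 = 2 * c.
  near=> n; apply: main; near: n; first exact: nbhs_infty_ge.
  exact: near_natM_expV_le.
case: n => // m _ nd c ca; rewrite /=.
have am0 : 0 < a ^+ m.+1 by rewrite exprn_gt0.
set d := 13 * a ^+ 2 / a ^+ m.+1.
have d0 : 0 < d by rewrite divr_gt0 // mulr_gt0 // exprn_gt0.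
have amd : a ^+ m * d = 13 * a.
  by rewrite /d [a ^+ m.+1]exprS; field; rewrite !gt_eqF // exprn_gt0.
have md : m.+1%:R * d <= a / 2 /\ m.+1%:R * d <= (a - 1) / 2.
  have -> : m.+1%:R * d = m.+1%:R / a ^+ m.+1 * (13 * a ^+ 2) by rewrite /d; ring.
  move: nd; rewrite /eps le_min => /andP[nd1 nd2]; split.
    apply: le_trans (ler_wpM2r _ nd1) _; first by rewrite mulr_ge0 // sqr_ge0.
    by rewrite le_eqVlt; apply/orP; left; apply/eqP; field; rewrite gt_eqF.
  apply: le_trans (ler_wpM2r _ nd2) _; first by rewrite mulr_ge0 // sqr_ge0.
  by rewrite le_eqVlt; apply/orP; left; apply/eqP; field; rewrite gt_eqF.
have [md1 md2] := md.
have m1 : 1 <= m.+1%:R :> R by rewrite (ler_nat _ 1).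
have dd : d <= m.+1%:R * d by rewrite ler_peMl // ltW.
have am1 : 1 < a - d by lra.
pose err r : R := a ^+ 2 * r ^- m - r ^- m.+2 - 2 * c * (r - r^-1).
pose P r : R := r ^+ m * (r ^+ 2 - a ^+ 2) + err r.
have Perr r : 1 < r -> r <= 2 * a -> `|err r| <= 6 * a ^+ 2.
  move=> r1 r2; have r0 : 0 < r by lra.
  have v k : 0 <= r ^- k <= 1.
    apply/andP; split; first by rewrite invr_ge0 exprn_ge0 // ltW.
    by rewrite invf_le1 ?exprn_gt0 // exprn_ege1 // ltW.
  have /andP[v1 v2] := v m; have /andP[v3 v4] := v m.+2.
  have : 0 <= r - r^-1 <= 2 * a.
    by have := v 1%N; rewrite expr1 => /andP[? ?]; apply/andP; split; lra.
  move=> /andP[w1 w2].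
  have h1 : `|2 * c * (r - r^-1)| <= 2 * a * (2 * a).
    by rewrite !normrM (ger0_norm w1) (@ger0_norm _ 2) // ler_pM ?mulr_ge0 // ler_wpM2l.
  have a2 : 1 < a ^+ 2 by rewrite exprn_egt1.
  have h2 : `|a ^+ 2 * r ^- m - r ^- m.+2| <= 2 * a ^+ 2.
    rewrite (le_trans (ler_normB _ _)) // !ger0_norm ?mulr_ge0 ?(ltW a0) //.
    have : a ^+ 2 * r ^- m <= a ^+ 2 by rewrite ler_piMr ?sqr_ge0.
    by lra.
  by apply: (le_trans (ler_normB _ _)); lra.
have Phi : 0 <= P (a + d).
  have := @Perr (a + d); rewrite ler_norml => /(_ _ _)/andP[||e1 _]; [lra|lra|].
  have : a ^+ m * (2 * a * d) <= (a + d) ^+ m * ((a + d) ^+ 2 - a ^+ 2).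
    apply: ler_pM.
    - by rewrite exprn_ge0 // ltW.
    - by rewrite mulr_ge0 ?(ltW d0) // mulr_ge0 ?(ltW a0).
    - by rewrite lerXn2r ?nnegrE //; lra.
    - by have := sqr_ge0 d; lra.
  have -> : a ^+ m * (2 * a * d) = 26 * a ^+ 2 by rewrite mulrCA amd; ring.
  by have := sqr_ge0 a; rewrite /P; lra.
have Plo : P (a - d) <= 0.
  have := @Perr (a - d); rewrite ler_norml => /(_ _ _)/andP[||_ e1]; [lra|lra|].
  have am : a ^+ m / 2 <= (a - d) ^+ m.
    have -> : a - d = a * (1 + - (d / a)) by field; rewrite gt_eqF.
    have da : -1 <= - (d / a) by rewrite lerN2 ler_pdivrMr // mul1r; lra.
    rewrite exprMn ler_wpM2l ?exprn_ge0 ?(ltW a0) //.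
    apply: le_trans (bernoulli m da).
    have : m%:R * (d / a) <= 2^-1; last by lra.
    rewrite mulrA ler_pdivrMr //; move: md1; rewrite mulrSr; lra.
  have : a ^+ m / 2 * (a * d) <= (a - d) ^+ m * (a ^+ 2 - (a - d) ^+ 2).
    apply: ler_pM => //; first by rewrite divr_ge0 // exprn_ge0 // ltW.
      by rewrite mulr_ge0 ?(ltW a0) ?(ltW d0).
    rewrite (_ : a ^+ 2 - (a - d) ^+ 2 = (2 * a - d) * d); last by ring.
    by rewrite ler_wpM2r ?(ltW d0) //; lra.
  have -> : a ^+ m / 2 * (a * d) = 13 / 2 * a ^+ 2.
    transitivity (a ^+ m * d * a / 2); first by ring.
    by rewrite amd; field.
  by have := sqr_ge0 a; rewrite /P; lra.
have Pc : {within `[a - d, a + d], continuous P}.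
  apply: derivable_within_continuous => y; rewrite in_itv /= => /andP[y1 _].
  have y0 : y != 0 by rewrite gt_eqF //; lra.
  have dV k : derivable (fun z : R => z ^- k) y 1.
    by apply: derivableV; [rewrite expf_neq0|exact: exprn_derivable].
  rewrite /P /err; apply: derivableD.
    apply: derivableM; first exact: exprn_derivable.
    by apply: derivableB; [exact: exprn_derivable|exact: derivable_cst].
  apply: derivableB; [apply: derivableB|apply: derivableM] => //.
    by apply: derivableM; [exact: derivable_cst|exact: dV].
  apply: derivableB; first exact: derivable_id.
  exact: dV 1%N.
have ad : a - d <= a + d by lra.
have [|r] := @IVT R P (a - d) (a + d) 0 ad Pc.
  by rewrite ge_min le_max Plo Phi orbT.
rewrite in_itv /= => /andP[r1 r2] Pr.
have r0 : r != 0 by rewrite gt_eqF //; lra.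
have rr : r - r^-1 != 0.
  have : r^-1 < 1 by rewrite invf_lt1; lra.
  by move=> h; rewrite gt_eqF // subr_gt0; lra.
exists r; first by split; [lra|rewrite ler_norml; apply/andP; split; lra].
apply: (mulfI rr); rewrite mulrBr mulrCA !chebU_hyp //.
apply/eqP; rewrite -subr_eq0; apply/eqP; rewrite -[RHS]Pr /P /err !exprS.
have rm : r ^+ m != 0 by rewrite expf_neq0.
by field; rewrite r0 rm.
Unshelve. all: by end_near. Qed.

(** * Location and expansion of the eigenvalues *)

Lemma normr_Re_le (R : realType) (z : R[i]) : `|complex.Re z| <= cmod z.
Proof.
rewrite -ler_sqr ?nnegrE ?normr_ge0 //; last by case: z => x y; exact: sqrtr_ge0.
by rewrite real_normK ?num_real // cmodE lerDl sqr_ge0.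
Qed.

Lemma lt_g (R : realType) (x y : R) : 0 < x -> x < y -> y < pi -> g x < g y.
Proof.
move=> x0 xy yp; have : cos y < cos x.
  by rewrite ltr_cos // in_itv /=; apply/andP; split; lra.
by rewrite !gE; lra.
Qed.

(** The candidates lo < 0 <= g (x 2) < ... < g (x (n-1)) <= 4 < hi are n
    distinct eigenvalues in ascending order. *)
Lemma lambda_located (R : realType) (alpha : R[i]) (n : nat) (lo hi : R)
    (x : nat -> R) :
  1 < cmod alpha -> (3 <= n)%N -> lo < 0 -> 4 < hi ->
  root (char_poly (Amx alpha n)) (lo%:C)%C ->
  root (char_poly (Amx alpha n)) (hi%:C)%C ->
  (forall j, (2 <= j <= n.-1)%N ->
     j.-1%:R * pi / n%:R < x j < j%:R * pi / n%:R /\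
     n%:R * x j = j%:R * pi + eta alpha j%:Z (x j)) ->
  [/\ lambda alpha n 1 = lo, lambda alpha n n = hi &
      forall j, (2 <= j <= n.-1)%N -> 0 < x j < pi /\ lambda alpha n j = g (x j)].
Proof.
move=> a1 n3 lo0 hi4 rlo rhi xP.
have n0 : 0 < n%:R :> R by rewrite ltr0n; lia.
have p0 := pi_gt0 R.
have xI j : (2 <= j <= n.-1)%N -> 0 < x j < pi.
  move=> jn; have [/andP[x1 x2] _] := xP j jn; apply/andP; split.
    by apply: lt_trans x1; rewrite divr_gt0 // mulr_gt0 // ltr0n; lia.
  apply: (lt_trans x2); rewrite ltr_pdivrMr // mulrC ltr_pM2l // ltr_nat; lia.
pose f i := if i == 0%N then lo else if i == n.-1 then hi else g (x i.+1).
have fE : forall i, (i < n)%N -> lambda alpha n i.+1 = f i.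
  apply: lambda_unique.
  - move=> i iN; rewrite /f /=.
    have [i0|i0] := eqVneq i 0%N; last have [iN1|iN1] := eqVneq i n.-1.
    + have -> : (i.+1 == n.-1) = false by lia.
      have := cos_le1 (x i.+2); rewrite gE; lra.
    + lia.
    + have [iN2|iN2] := eqVneq i.+1 n.-1.
        have := cos_geN1 (x i.+1); rewrite gE; lra.
      have j1 : (2 <= i.+1 <= n.-1)%N by lia.
      have j2 : (2 <= i.+2 <= n.-1)%N by lia.
      have [/andP[_ u1] _] := xP _ j1; have [/andP[u2 _] _] := xP _ j2.
      have /andP[v1 _] := xI _ j1; have /andP[_ v2] := xI _ j2.
      by apply: lt_g => //; exact: lt_trans u1 u2.
  - move=> i iN; rewrite /f.
    have [//|i0] := eqVneq i 0%N; have [//|iN1] := eqVneq i n.-1.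
    have j1 : (2 <= i.+1 <= n.-1)%N by lia.
    have [_] := xP _ j1; have -> : n = n.-1.+1 by lia.
    move=> /(eta_root a1 (xI _ j1)) E.
    rewrite gE; apply: chebU_root_char_poly => //; lia.
split.
- by rewrite fE //; lia.
- have {1}-> : n = n.-1.+1 by lia.
  rewrite [LHS](_ : _ = lambda alpha n n.-1.+1); last by congr lambda; lia.
  rewrite fE /f ?eqxx; last by lia.
  by have -> : (n.-1 == 0%N) = false by lia.
- move=> j jn; split; first exact: xI.
  have -> : j = j.-1.+1 by lia.
  rewrite fE /f /=; last by lia.
  have -> : (j.-1 == 0%N) = false by lia.
  by have -> : (j.-1 == n.-1) = false by lia.
Qed.

(** The map r -> r + 1/r is Lipschitz on r > 1, and it sends |alpha| to
    s_alpha + 2. *)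
Lemma outer_eigenvalues (R : realType) (alpha : R[i]) : 1 < cmod alpha ->
  \forall n \near \oo, exists lo hi : R,
    [/\ lo < 0, 4 < hi, root (char_poly (Amx alpha n)) (lo%:C)%C &
        root (char_poly (Amx alpha n)) (hi%:C)%C] /\
    `|lo + s_ alpha| <= 26 * cmod alpha ^+ 2 / cmod alpha ^+ n /\
    `|hi - 4 - s_ alpha| <= 26 * cmod alpha ^+ 2 / cmod alpha ^+ n.
Proof.
move=> a1; have Re_le := normr_Re_le alpha.
rewrite /s_; apply: filterS2 (nbhs_infty_ge 3) (outer_root a1) => n.
case: n => // m m2; rewrite [m.+1.-1]/= => out.
set a := cmod alpha in a1 Re_le out *; set c := complex.Re alpha in Re_le *.
set d := 13 * _ / _ in out.
have joukowski (r : R) : 1 < r -> `|r - a| <= d ->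
    2 < r + r^-1 /\ `|(r + r^-1) - (a + a^-1)| <= 2 * d.
  move=> r1 rd; have r0 : 0 < r by lra.
  have rV : r^-1 < 1 by rewrite invf_lt1.
  have aV : a^-1 < 1 by rewrite invf_lt1 //; lra.
  have a0 : 0 < a by lra.
  split.
    rewrite -subr_gt0 (_ : _ - 2 = (r - 1) ^+ 2 / r).
      by rewrite divr_gt0 // exprn_gt0 // subr_gt0.
    by field; rewrite gt_eqF.
  have -> : r + r^-1 - (a + a^-1) = (r - a) * (1 - r^-1 * a^-1).
    by field; rewrite !gt_eqF.
  have v : 0 <= r^-1 * a^-1 <= 1.
    have rV0 : 0 <= r^-1 by rewrite invr_ge0 ltW.
    have aV0 : 0 <= a^-1 by rewrite invr_ge0 ltW.
    by apply/andP; split; [rewrite mulr_ge0|rewrite mulr_ile1 // ltW].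
  rewrite normrM mulrC; apply: ler_pM => //.
  by rewrite ler_norml; lra.
have [r1 [r11 r1d] E1] := out c Re_le.
(* Here n = m + 1; U_k has the parity of k - 1, so t -> - t multiplies the
   left-hand side of the equation by (-1)^n. *)
have [|r2 [r21 r2d] E2] := out ((-1) ^+ m.+1 * c).
  by rewrite normrM normrX normrN1 expr1n mul1r.
have [t1 b1] := joukowski r1 r11 r1d; have [t2 b2] := joukowski r2 r21 r2d.
have dE : 26 * a ^+ 2 / a ^+ m.+1 = 2 * d by rewrite /d; ring.
exists (2 - (r1 + r1^-1)), (2 - (- (r2 + r2^-1))); rewrite dE; split; [split|split].
- lra.
- lra.
- exact: chebU_root_char_poly.
- apply: chebU_root_char_poly => //; rewrite !chebU_opp -/a -/c.
  have sg : (-1) ^+ m.+1 * (-1) ^+ m.+1 = 1 :> R by rewrite -expr2 sqrr_sign.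
  transitivity ((-1) ^+ m.+1 * (chebU (r2 + r2^-1) m.+2 - a ^+ 2 * chebU (r2 + r2^-1) m)).
    by rewrite [(-1) ^+ m.+3]exprS [(-1) ^+ m.+2]exprS; ring.
  by rewrite E2 mulrCA [_ * (_ * c)]mulrA sg mul1r.
- by rewrite -normrN [X in `|X|](_ : _ = r1 + r1^-1 - (a + a^-1)) //; ring.
- by rewrite [X in `|X|](_ : _ = r2 + r2^-1 - (a + a^-1)) //; ring.
Qed.

(** The constant is the one of [perturbed_expansion] with E = pi and with the
    constants of [phase_lip] and [phase_taylor], none of which involves p. *)
Lemma inner_expansion (R : realType) (alpha : R[i]) : 1 < cmod alpha ->
  exists2 C : R, 0 < C & forall (n j : nat) (x : R),
    (2 <= j <= n.-1)%N -> 0 < x < pi ->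
    n%:R * x = j%:R * pi + eta alpha j%:Z x ->
    `|g x - lambda_asympt alpha n j| <= C / n%:R ^+ 3.
Proof.
move=> a1.
set A := cmod alpha ^+ 2 - 1; set B := cmod alpha ^+ 2 + 1.
pose K := (A + 2 * B) / A.
pose L := 2 * (A + 2 * B) * ((A + 2 * B) * (K + 1)) / A ^+ 2.
have [A0 B0 _] : phase_adm A B _ := eta_adm a1 0.
have K0 : 0 <= K by rewrite /K divr_ge0 //; lra.
have L0 : 0 <= L by rewrite /L divr_ge0 ?sqr_ge0 // !mulr_ge0 //; lra.
have p0 := pi_gt0 R.
exists (2 * (K ^+ 2 * pi + L * pi ^+ 2) + 2 * K * pi ^+ 2 + 4 * pi ^+ 3).
  have p2 k : 0 <= pi ^+ k :> R by rewrite exprn_ge0 // ltW.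
  have h1 : 0 <= K ^+ 2 * pi by rewrite mulr_ge0 ?sqr_ge0 // ltW.
  have h2 : 0 <= L * pi ^+ 2 by rewrite mulr_ge0.
  have h3 : 0 <= K * pi ^+ 2 by rewrite mulr_ge0.
  have h4 : 0 < pi ^+ 3 :> R by rewrite exprn_gt0.
  lra.
move=> n j x jn xI xE.
have n0 : 0 < n%:R :> R by rewrite ltr0n; lia.
rewrite /lambda_asympt derive1_g derive1n2_g !gE.
set t := j%:R * pi / n%:R.
have tI : 0 < t < pi.
  apply/andP; split; first by rewrite divr_gt0 // mulr_gt0 // ltr0n; lia.
  by rewrite ltr_pdivrMr // mulrC ltr_pM2l // ltr_nat; lia.
have adm := eta_adm a1 j; have eE := eta_phase a1 j.
rewrite -/A -/B in adm eE; set p := _ * _ in adm eE.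
have dE : derive1 (phase A B p) t = dphase A B p t.
  rewrite derive1E; apply: derive_val.
  exact: phase_derive adm (sin_neq0_pi tI).
have pb y : `|phase A B p y| <= pi.
  have /andP[] := phase_bound y adm => ? ?; rewrite ler_norml; apply/andP; split; lra.
rewrite eE dE in xE *.
have := @perturbed_expansion R pi K L (n%:R)^-1 t x (phase A B p t)
  (phase A B p x) (dphase A B p t) (ltW p0) K0 L0.
rewrite invr_ge0 (ltW n0) => /(_ isT (pb _) (pb _)).
move=> /(_ (dphase_bound adm tI)) /(_ _ (phase_lip adm tI xI) (phase_taylor adm tI xI)).
rewrite -(exprVn _ 3) => H.
rewrite [X in `|X|](_ : _ = 2 * cos t - 2 * cos x -
  (2 * sin t * phase A B p t / n%:R + (2 * sin t * phase A B p t * dphase A B p t +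
     1 / 2 * (2 * cos t) * phase A B p t ^+ 2) * n%:R^-1 ^+ 2));
  last by rewrite exprVn; ring.
apply: H; apply: (mulfI (lt0r_neq0 n0)); rewrite xE /t.
by field; rewrite gt_eqF.
Qed.

Unset Implicit Arguments.

Theorem theorem6 (R : realType) (alpha : R[i]) (halpha : 1 < cmod alpha) :
  (exists C2 : R, 0 < C2 /\
    \forall n \near \oo,
      `|lambda alpha n 1 + s_ alpha| <= C2 / cmod alpha ^+ n /\
      `|lambda alpha n n - 4 - s_ alpha| <= C2 / cmod alpha ^+ n) /\
  (exists C1 : R, 0 < C1 /\
    \forall n \near \oo,
      forall j : nat, (2 <= j <= n.-1)%N ->
        `|lambda alpha n j - lambda_asympt alpha n j| <= C1 / n%:R ^+ 3).
Proof.
have located : \forall n \near \oo, exists lo hi : R, exists x : nat -> R,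
  (`|lo + s_ alpha| <= 26 * cmod alpha ^+ 2 / cmod alpha ^+ n /\
   `|hi - 4 - s_ alpha| <= 26 * cmod alpha ^+ 2 / cmod alpha ^+ n) /\
  [/\ lambda alpha n 1 = lo, lambda alpha n n = hi &
      forall j, (2 <= j <= n.-1)%N ->
        [/\ 0 < x j < pi, n%:R * x j = j%:R * pi + eta alpha j%:Z (x j) &
            lambda alpha n j = g (x j)]].
  apply: filterS2 (nbhs_infty_ge 3) (outer_eigenvalues halpha) => n n3.
  move=> [lo [hi [[lo0 hi4 rlo rhi] bounds]]].
  have /choice[x xP] : forall j, exists x : R, (2 <= j <= n.-1)%N ->
     j.-1%:R * pi / n%:R < x < j%:R * pi / n%:R /\
     n%:R * x = j%:R * pi + eta alpha j%:Z x.
    move=> j; have [jn|_] := boolP (2 <= j <= n.-1)%N; last by exists 0.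
    by have [x x1 x2] := eta_fixpoint halpha jn; exists x.
  have [l1 ln lj] := lambda_located halpha n3 lo0 hi4 rlo rhi xP.
  exists lo, hi, x; split=> //; split=> // j jn.
  by have [xI lE] := lj j jn; have [_ xE] := xP j jn.
have [C1 C10 expansion] := inner_expansion halpha.
split; [exists (26 * cmod alpha ^+ 2)|exists C1]; split=> //.
- by rewrite mulr_gt0 // exprn_gt0 // (lt_trans _ halpha).
- by apply: filterS located => n [lo [hi [x [bounds [-> -> _]]]]].
- apply: filterS located => n [lo [hi [x [_ [_ _ xP]]]]] j jn.
  by have [xI xE ->] := xP j jn; exact: expansion.
Qed.
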